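(* Let $(X,\tau)$ be a barreled extended locally convex space and let $M$ be a closed linear subspace of $(X,\tau)$. Then the quotient space $X/M$ with the quotient topology $\pi(\tau)$ is a barreled extended locally convex space.
   Context: Vector spaces are over $\mathbb{K}\in\{\mathbb{R},\mathbb{C}\}$. An extended seminorm on a vector space $X$ is a map $\rho:X\to[0,\infty]$ with $\rho(\alpha x)=|\alpha|\rho(x)$ (convention $0\cdot\infty=0$) and $\rho(x+y)\le\rho(x)+\rho(y)$. An extended locally convex space (elcs) is a vector space $X$ with a Hausdorff topology $\tau$ induced by a family $\mathcal{P}$ of extended seminorms, i.e. the sets $\{y\in X:\rho(y-x)<\epsilon\}$ ($\rho\in\mathcal{P}$, $x\in X$, $\epsilon>0$) form a subbase of $\tau$. A barrel in an elcs is a closed, absolutely convex (balanced and convex), absorbing subset; an elcs is barreled if every barrel in it is a neighborhood of $0$. $\pi:X\to X/M$, $\pi(x)=x+M$, is the quotient map, and $\pi(\tau)$ is the corresponding quotient topology. *)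

(* Defs.v *)
From HB Require Import structures.
From mathcomp Require Import all_boot all_order all_algebra.
From mathcomp Require Import all_classical all_reals all_analysis.
From mathcomp Require Import complex.

Set Implicit Arguments.
Unset Strict Implicit.
Unset Printing Implicit Defensive.

Import Order.TTheory GRing.Theory Num.Theory.

Local Open Scope classical_set_scope.
Local Open Scope ring_scope.
Local Open Scope quotient_scope.

Variant scalar_kind := RealScalars | ComplexScalars.

Definition scalars (R : realType) (k : scalar_kind) : numFieldType :=
  match k with
  | RealScalars => R
  | ComplexScalars => R[i]
  end.

(* The norm of the numFieldType R[i] takes its values in R[i]; here the
   absolute value has to be an element of R. *)
Definition modulus (R : realType) (k : scalar_kind) : scalars R k -> R :=
  match k with
  | RealScalars => fun a : R => `|a|
  | ComplexScalars => fun a : R[i] => Normc.normc a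
  end.

Definition subbase (T : topologicalType) (S : set (set T)) : Prop :=
  basis (finI_from S id).

Section Elcs.
Variables (R : realType) (k : scalar_kind).
Local Notation K := (scalars R k).

(* In \bar R, 0 * +oo = 0. *)
Definition extended_seminorm (X : lmodType K) (rho : X -> \bar R) : Prop :=
  [/\ forall x, (0 <= rho x)%E,
      forall (a : K) x, rho (a *: x) = ((modulus a)%:E * rho x)%E
    & forall x y, (rho (x + y)%R <= rho x + rho y)%E].

Definition seminorm_ball (X : lmodType K) (rho : X -> \bar R) (x : X) (e : R)
    : set X :=
  [set y | (rho (y - x)%R < e%:E)%E].

(* The structure preTopologicalLmodType imposes no compatibility between the
   topology and the operations: scaling need not be continuous in an elcs. *)
Definition elcs (X : preTopologicalLmodType K) : Prop :=
  hausdorff_space X /\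
  exists P : set (X -> \bar R),
    (forall rho, P rho -> extended_seminorm rho) /\
    subbase [set B : set X | exists rho x e,
               [/\ P rho, 0 < e & B = seminorm_ball rho x e]].

Definition balanced (X : lmodType K) (A : set X) : Prop :=
  forall (a : K) x, modulus a <= 1 -> A x -> A (a *: x).

(* The coefficients of convex_set are the t : K with 0 <= t <= 1; in R[i]
   this order relation forces t to be real. *)
Definition absolutely_convex (X : lmodType K) (A : set X) : Prop :=
  balanced A /\ @convex_set K X A.

Definition absorbing (X : lmodType K) (A : set X) : Prop :=
  forall x, exists2 r : R, 0 < r &
    forall a : K, modulus a <= r -> A (a *: x).

Definition barrel (X : preTopologicalLmodType K) (B : set X) : Prop :=
  [/\ closed B, absolutely_convex B & absorbing B].

Definition barreled (X : preTopologicalLmodType K) : Prop :=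
  forall B : set X, barrel B -> nbhs (0 : X) B.

Definition barreled_elcs (X : preTopologicalLmodType K) : Prop :=
  elcs X /\ barreled X.

End Elcs.

(* A submodClosed predicate is closed under opposite because the scalars form
   a ring, but the library does not infer zmodClosed from it. *)
Section SubmodZmod.
Variables (K : pzRingType) (X : lmodType K) (M : submodClosed X).

Definition submod_pred : X -> bool := fun x => x \in M.

Lemma submod_pred_zmod_closed : zmod_closed submod_pred.
Proof. exact: GRing.submod_closedB (GRing.submodClosedP M). Qed.

HB.instance Definition _ :=
  GRing.isZmodClosed.Build X submod_pred submod_pred_zmod_closed.

Definition submod_zmod : zmodClosed X :=
  GRing.ZmodClosed.clone X submod_pred _.

End SubmodZmod.

Section QuotientSpace.
Variables (K : numDomainType) (X : preTopologicalLmodType K).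
Variable M : submodClosed X.

Definition quotient_space : Type := quotient_topology (Quotient.quot (submod_zmod M)).

HB.instance Definition _ := Topological.on quotient_space.
HB.instance Definition _ := Quotient.on quotient_space.

(* The zmodType of Quotient.quot is built on a choiceType that is not
   convertible to the one of quotient_topology, so it cannot be copied. *)
HB.instance Definition _ := GRing.isZmodule.Build quotient_space
  (@Quotient.addqA X (submod_zmod M)) (@Quotient.addqC X (submod_zmod M))
  (@Quotient.add0q X (submod_zmod M)) (@Quotient.addNq X (submod_zmod M)).

Local Notation pi := (\pi_quotient_space : X -> quotient_space).

Lemma quotient_piE (x y : X) : (x - y \in M) = (pi x == pi y).
Proof.
have -> : (x - y \in M) = (x - y \in submod_zmod M) by [].
by rewrite Quotient.idealrBE; apply/eqP/eqP.
Qed.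

Lemma quotient_piD (x y : X) : pi (x + y) = pi x + pi y.
Proof. exact: (@Quotient.pi_add X (submod_zmod M)). Qed.

Definition quotient_scale (a : K) (q : quotient_space) : quotient_space :=
  pi (a *: repr q).

Lemma quotient_piZ_subproof (a : K) (x : X) :
  pi (a *: x) = quotient_scale a (pi x).
Proof.
apply/eqP; rewrite -quotient_piE -scalerBr GRing.rpredZ // quotient_piE.
by rewrite reprK.
Qed.

Lemma quotient_scaleA (a b : K) (q : quotient_space) :
  quotient_scale a (quotient_scale b q) = quotient_scale (a * b) q.
Proof. by rewrite -quotient_piZ_subproof scalerA. Qed.

Lemma quotient_scale1 : left_id 1 quotient_scale.
Proof. by move=> q; rewrite /quotient_scale scale1r reprK. Qed.

Lemma quotient_scaleDr : right_distributive quotient_scale +%R.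
Proof.
move=> a p q; rewrite -[p]reprK -[q]reprK -quotient_piD.
by rewrite -!quotient_piZ_subproof scalerDr quotient_piD.
Qed.

Lemma quotient_scaleDl (q : quotient_space) :
  {morph quotient_scale^~ q : a b / a + b}.
Proof. by move=> a b; rewrite /quotient_scale scalerDl quotient_piD. Qed.

HB.instance Definition _ := GRing.Zmodule_isLmodule.Build K quotient_space
  quotient_scaleA quotient_scale1 quotient_scaleDr quotient_scaleDl.

Lemma quotient_piZ (a : K) (x : X) : pi (a *: x) = a *: pi x.
Proof. exact: quotient_piZ_subproof. Qed.

Lemma quotient_openE (U : set quotient_space) : open U = open (pi @^-1` U).
Proof. by []. Qed.

End QuotientSpace.

(* Main.v *)
(* The neighborhoods of a point in an elcs are generated by the balls of single
   continuous extended seminorms, because the continuous ones are closed under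
   finite maxima.  Each continuous rho on X induces on X/M the continuous
   extended seminorm q |-> inf {rho z | pi z = q}, whose e-ball around pi x is
   exactly the image of the e-ball of rho around x.  These seminorms generate
   the quotient topology, and they separate points because M is closed.  The
   preimage under pi of a barrel is a barrel, so it contains a ball, and the
   image of that ball is a ball inside the original barrel. *)
Require Import Defs.
From mathcomp Require Import all_boot all_order all_algebra.
From mathcomp Require Import all_classical all_reals all_analysis.
From mathcomp Require Import complex finmap.

Set Implicit Arguments.
Unset Strict Implicit.
Unset Printing Implicit Defensive.

Import Order.TTheory GRing.Theory Num.Theory.

Local Open Scope classical_set_scope.
Local Open Scope ring_scope.

(** * Absolute values over both scalar fields *)

Section Modulus.
Variables (R : realType) (k : scalar_kind).
Implicit Types a : scalars R k.

Lemma modulus_ge0 a : 0 <= modulus a.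
Proof. by case: k a => //= -[x y]; exact: sqrtr_ge0. Qed.

Lemma modulus0 : modulus (0 : scalars R k) = 0.
Proof. by case: k => /=; [exact: normr0 | exact: Normc.normc0]. Qed.

Lemma modulus1 : modulus (1 : scalars R k) = 1.
Proof. by case: k => /=; [exact: normr1 | exact: Normc.normc1]. Qed.

Lemma modulusM a b : modulus (a * b) = modulus a * modulus b.
Proof. by case: k a b => /= a b; [exact: normrM | exact: Normc.normcM]. Qed.

Lemma modulusN1 : modulus (-1 : scalars R k) = 1.
Proof.
(* Comparing squares of nonnegative reals avoids a case split on the scalar field. *)
apply/eqP; rewrite -(@pexpr_eq1 _ _ 2) ?modulus_ge0 //.
by rewrite expr2 -modulusM mulrNN mulr1 modulus1.
Qed.

End Modulus.

(** * Extended seminorms and their balls *)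

Section ExtendedSeminorm.
Variables (R : realType) (k : scalar_kind) (X : lmodType (scalars R k)).
Variable rho : X -> \bar R.
Hypothesis rhoP : extended_seminorm rho.

Lemma extended_seminorm_ge0 x : (0 <= rho x)%E.
Proof. by case: rhoP. Qed.

Lemma extended_seminorm0 : rho 0 = 0%E.
Proof. by case: rhoP => _ rhoZ _; rewrite -(scale0r 0) rhoZ modulus0 mul0e. Qed.

Lemma extended_seminorm_distC x y : rho (x - y) = rho (y - x).
Proof.
case: rhoP => _ rhoZ _.
by rewrite -(opprB y x) -(scaleN1r (y - x)) rhoZ modulusN1 mul1e.
Qed.

Lemma extended_seminorm_dist_triangle y x z :
  (rho (x - z) <= rho (x - y) + rho (y - z))%E.
Proof.
by case: rhoP => _ _ rhoD; rewrite -(subrKA y x (- z)).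
Qed.

Lemma seminorm_ball_center x (e : R) : 0 < e -> seminorm_ball rho x e x.
Proof.
by move=> e0; rewrite /seminorm_ball /= subrr extended_seminorm0 lte_fin.
Qed.

(** Being below [r], the distance [rho (x - c)] is finite even though [rho] may take the value
    [+oo], so [r - rho (x - c)] is a real radius. *)
Lemma seminorm_ball_recenter c x (r : R) : seminorm_ball rho c r x ->
  exists2 e : R, 0 < e & seminorm_ball rho x e `<=` seminorm_ball rho c r.
Proof.
rewrite /seminorm_ball /= => xc.
have xc_fin : rho (x - c) \is a fin_num.
  by rewrite ge0_fin_numE ?extended_seminorm_ge0 // (lt_trans xc) ?ltry.
exists (r - fine (rho (x - c))).
  by rewrite subr_gt0 -lte_fin fineK.
move=> y /=; rewrite EFinB fineK // lteBrDr // => yx.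
exact: le_lt_trans (extended_seminorm_dist_triangle x _ _) yx.
Qed.

End ExtendedSeminorm.

Lemma extended_seminorm_max (R : realType) (k : scalar_kind)
    (X : lmodType (scalars R k)) (rho sigma : X -> \bar R) :
  extended_seminorm rho -> extended_seminorm sigma ->
  extended_seminorm (fun x => maxe (rho x) (sigma x)).
Proof.
move=> [rho0 rhoZ rhoD] [sigma0 sigmaZ sigmaD]; split.
- by move=> x; rewrite le_max rho0.
- by move=> a x; rewrite rhoZ sigmaZ maxe_pMr ?lee_fin ?modulus_ge0.
- move=> x y; rewrite ge_max; apply/andP; split.
    by apply: le_trans (rhoD _ _) _; apply: leeD; rewrite le_max lexx.
  by apply: le_trans (sigmaD _ _) _; apply: leeD; rewrite le_max lexx orbT.
Qed.

(** * Continuous extended seminorms and the topology they generate *)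

Section SeminormTopology.
Variables (R : realType) (k : scalar_kind).
Variable X : preTopologicalLmodType (scalars R k).
Implicit Types (rho : X -> \bar R) (x : X) (e : R).

(** Balls around every center are required to be open, since the type of [X] does not make
    translations continuous. *)
Definition continuous_seminorm rho :=
  extended_seminorm rho /\ forall x e, 0 < e -> open (seminorm_ball rho x e).

Lemma seminorm_ball_max rho sigma x e :
  seminorm_ball (fun y => maxe (rho y) (sigma y)) x e =
  seminorm_ball rho x e `&` seminorm_ball sigma x e.
Proof.
by apply/seteqP; split=> y; rewrite /seminorm_ball /= gt_max => /andP.
Qed.

Lemma continuous_seminorm_max rho sigma :
  continuous_seminorm rho -> continuous_seminorm sigma ->
  continuous_seminorm (fun x => maxe (rho x) (sigma x)).
Proof.
move=> [rhoP rho_open] [sigmaP sigma_open]; split.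
  exact: extended_seminorm_max.
by move=> x e e0; rewrite seminorm_ball_max; apply: openI; auto.
Qed.

(** The zero seminorm makes the family nonempty; two balls are handled by the maximum of the
    seminorms and the minimum of the radii. The filter property is what absorbs finite intersections
    of subbasic sets. *)
Lemma continuous_seminorm_ball_filter x :
  Filter (filter_from [set p : (X -> \bar R) * R |
                        continuous_seminorm p.1 /\ 0 < p.2]
                      (fun p => seminorm_ball p.1 x p.2)).
Proof.
apply: filter_from_filter.
  exists (fun=> 0%E, 1) => /=; split=> //; split.
    by split=> *; rewrite ?mule0 ?adde0.
  move=> y e e0; rewrite (_ : seminorm_ball _ _ _ = setT); first exact: openT.
  by apply/seteqP; split=> z; rewrite /seminorm_ball /= ?lte_fin.
move=> [rho r] [sigma s] /= [rhoP r0] [sigmaP s0].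
exists (fun y => maxe (rho y) (sigma y), Num.min r s) => /=.
  by split; [exact: continuous_seminorm_max | rewrite lt_min r0].
rewrite seminorm_ball_max => y [] ry sy.
by split; [apply: lt_le_trans ry _ | apply: lt_le_trans sy _];
  rewrite lee_fin ge_min lexx ?orbT.
Qed.

(** This trades an unspecified generating family for a local criterion that passes easily to the
    quotient. Conversely, the family of all continuous seminorms serves as generating family. *)
Lemma seminorm_topologyP :
  (exists P : set (X -> \bar R),
    (forall rho, P rho -> extended_seminorm rho) /\
    subbase [set B : set X | exists rho x e,
               [/\ P rho, 0 < e & B = seminorm_ball rho x e]]) <->
  forall x (U : set X), nbhs x U ->
    exists rho (e : R), [/\ continuous_seminorm rho, 0 < e &
                      seminorm_ball rho x e `<=` U].
Proof.
split.
  move=> [P [Psemi [Bopen Bnbhs]]] x U /Bnbhs /= [V [[D DB <-] Dx] VU].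
  have [] : filter_from [set p : (X -> \bar R) * R |
                          continuous_seminorm p.1 /\ 0 < p.2]
                        (fun p => seminorm_ball p.1 x p.2)
                        (\bigcap_(B in [set` D]) id B).
    apply: filter_bigI; first exact: continuous_seminorm_ball_filter.
    move=> B BD; have /DB/set_mem [rho [c [r [Prho r0 BE]]]] := BD.
    have := Dx _ BD; rewrite /= BE => /(seminorm_ball_recenter (Psemi _ Prho)).
    move=> [e e0 sub]; exists (rho, e) => //=; split=> //; split.
      exact: Psemi.
    (* Members of [P] are continuous because their balls are subbasic, hence open. *)
    move=> y s s0; apply: Bopen; apply: (finI_from1 id).
    by exists rho, y, s.
  move=> [rho e] /= [rhoP e0] sub; exists rho, e; split=> //.
  exact: subset_trans sub VU.
move=> base; exists [set rho | continuous_seminorm rho]; split=> [rho []//|].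
split.
  move=> _ [D DB <-]; rewrite openE => x Dx.
  apply: filter_bigI => B BD; have := Dx _ BD; have /DB/set_mem := BD.
  move=> [rho [y [e [[_ rho_open] e0 ->]]]] Bx.
  by apply: open_nbhs_nbhs; split=> //; exact: rho_open.
move=> x U /base [rho [e [rhoP e0 sub]]].
exists (seminorm_ball rho x e) => //; split.
  by apply: (finI_from1 id); exists rho, x, e.
by apply: seminorm_ball_center => //; case: rhoP.
Qed.

End SeminormTopology.

(** * Quotient seminorms and the topology of the quotient *)

Section QuotientSeminorm.
Variables (R : realType) (k : scalar_kind).
Variables (X : preTopologicalLmodType (scalars R k)) (M : submodClosed X).
Local Notation pi := (\pi_(quotient_space M)%qT : X -> quotient_space M).

Lemma quotient_pi_surj (q : quotient_space M) : exists x, pi x = q.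
Proof. by exists (repr q); rewrite reprK. Qed.

Lemma quotient_pi0 : pi 0 = 0.
Proof. by rewrite -(scale0r 0) quotient_piZ scale0r. Qed.

Lemma quotient_piB x y : pi (x - y) = pi x - pi y.
Proof. by rewrite quotient_piD -scaleN1r quotient_piZ scaleN1r. Qed.

Lemma quotient_pi_eq0 x : pi x = 0 <-> x \in M.
Proof.
by rewrite -[x in x \in M]subr0 quotient_piE quotient_pi0; split=> /eqP.
Qed.

Definition quotient_seminorm (rho : X -> \bar R) (q : quotient_space M)
    : \bar R :=
  ereal_inf [set rho z | z in [set z | pi z = q]].

Lemma quotient_seminorm_le rho x : (quotient_seminorm rho (pi x) <= rho x)%E.
Proof. by apply: ereal_inf_lbound; exists x. Qed.

(** The infimum need not be attained, but a strict bound always passes to some representative; balls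
    of the quotient are therefore images of balls. *)
Lemma quotient_seminorm_lt rho q (e : \bar R) :
  (quotient_seminorm rho q < e)%E <-> exists2 z, pi z = q & (rho z < e)%E.
Proof.
split=> [/ereal_inf_lt[_ [z zq <-] ze]|[z <- ze]]; first by exists z.
exact: le_lt_trans (quotient_seminorm_le _ _) ze.
Qed.

Lemma extended_quotient_seminorm rho :
  extended_seminorm rho -> extended_seminorm (quotient_seminorm rho).
Proof.
move=> rhoP; have [rho0 rhoZ rhoD] := rhoP.
have q0 q : (0 <= quotient_seminorm rho q)%E.
  by apply: le_ereal_inf_tmp => _ [z _ <-].
have leZ a q : a != 0 ->
    ((modulus a)%:E * quotient_seminorm rho q <=
     quotient_seminorm rho (a *: q))%E.
  move=> a0; apply: le_ereal_inf_tmp => _ [z /= zaq <-].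
  rewrite -[z]scale1r -(mulfV a0) -scalerA rhoZ.
  apply: lee_wpmul2l; first by rewrite lee_fin modulus_ge0.
  by apply: ereal_inf_lbound; exists (a^-1 *: z) => //=;
    rewrite quotient_piZ zaq scalerA mulVf // scale1r.
split=> //.
- move=> a q; have [->|a0] := eqVneq a 0.
    rewrite scale0r modulus0 mul0e; apply/eqP; rewrite eq_le q0 andbT.
    by rewrite -quotient_pi0 -(extended_seminorm0 rhoP) quotient_seminorm_le.
  apply/eqP; rewrite eq_le leZ // andbT.
  (* The reverse inequality is [leZ] for the inverse scalar, multiplied through by [modulus a]. *)
  have := leZ a^-1 (a *: q).
  rewrite invr_eq0 scalerA mulVf // scale1r => /(_ a0) le1.
  rewrite -[leLHS]mul1e -(modulus1 R k) -(mulfV a0) modulusM EFinM -muleA.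
  by apply: lee_wpmul2l => //; rewrite lee_fin modulus_ge0.
- move=> p q.
  (* Infinite values are split off first: only at a finite value does adding [e / 2] give a strictly
     larger bound, hence an almost minimal representative. *)
  have [->|pfin] := eqVneq (quotient_seminorm rho p) +oo%E.
    by rewrite addye ?leey // gt_eqF // (lt_le_trans ltNy0).
  have [->|qfin] := eqVneq (quotient_seminorm rho q) +oo%E.
    by rewrite addey ?leey // gt_eqF // (lt_le_trans ltNy0).
  apply/lee_addgt0Pr => e e0.
  have e20 : 0 < e / 2 by rewrite divr_gt0.
  have adh r : quotient_seminorm rho r != +oo%E ->
      exists2 z, pi z = r & (rho z < quotient_seminorm rho r + (e / 2)%:E)%E.
    move=> rfin; apply/quotient_seminorm_lt; rewrite lteDl ?lte_fin //.
    by rewrite ge0_fin_numE // ltey.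
  have [x xp xlt] := adh p pfin; have [y yq ylt] := adh q qfin.
  rewrite -xp -yq -quotient_piD.
  apply: le_trans (quotient_seminorm_le _ _) (le_trans (rhoD _ _) _).
  rewrite xp yq (_ : e = e / 2 + e / 2); last by rewrite -splitr.
  by rewrite EFinD addeACA; apply: leeD; exact: ltW.
Qed.

(** The preimage of a quotient ball is the union of the [rho]-balls of the same radius centered at
    the points of the coset [x + M]. *)
Lemma continuous_quotient_seminorm rho :
  continuous_seminorm rho -> continuous_seminorm (quotient_seminorm rho).
Proof.
move=> [rhoP rho_open]; split; first exact: extended_quotient_seminorm.
move=> q e e0; have [x <-] := quotient_pi_surj q.
rewrite quotient_openE.
rewrite (_ : _ @^-1` _ = \bigcup_(m in [set` M]) seminorm_ball rho (x + m) e).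
  by apply: bigcup_open => m _; exact: rho_open.
apply/seteqP; split=> y.
  rewrite /seminorm_ball /= -quotient_piB => /quotient_seminorm_lt[z zE ze].
  exists (y - x - z); first by rewrite /= quotient_piE zE.
  by rewrite /= (_ : y - _ = z) // addrA [x + _]addrC subrK opprB addrC subrK.
move=> [m /= mM ym]; rewrite /seminorm_ball /= -quotient_piB.
apply/quotient_seminorm_lt; exists (y - (x + m)) => //.
have /quotient_pi_eq0 pm0 := mM.
by rewrite opprD addrA [LHS]quotient_piB pm0 subr0.
Qed.

Lemma quotient_seminorm_ball_sub rho x (e : R) (U : set (quotient_space M)) :
  seminorm_ball rho x e `<=` pi @^-1` U ->
  seminorm_ball (quotient_seminorm rho) (pi x) e `<=` U.
Proof.
move=> sub q; have [y <-] := quotient_pi_surj q.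
rewrite /seminorm_ball /= -quotient_piB => /quotient_seminorm_lt[z zE ze].
have -> : pi y = pi (z + x) by rewrite quotient_piD zE quotient_piB subrK.
by apply: sub; rewrite /seminorm_ball /= addrK.
Qed.

(** If [pi x] and [pi y] differ, some ball of radius [e] around [x - y] misses the closed set [M].
    This forces the quotient seminorm of [pi x - pi y] to be at least [e], so balls of radius
    [e / 2] are disjoint. *)
Lemma quotient_hausdorff :
  (forall (x : X) (U : set X), nbhs x U ->
    exists rho (e : R), [/\ continuous_seminorm rho, 0 < e &
                      seminorm_ball rho x e `<=` U]) ->
  closed [set` M] -> hausdorff_space (quotient_space M).
Proof.
move=> base Mclosed; rewrite open_hausdorff => p q.
have [x <-] := quotient_pi_surj p; have [y <-] := quotient_pi_surj q => xy.
have : nbhs (x - y) (~` [set` M]).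
  apply: open_nbhs_nbhs; split; first by rewrite openC.
  by rewrite /= quotient_piE; apply/negP.
move=> /base [rho [e [rhoP e0 sub]]].
have [sP sopen] := continuous_quotient_seminorm rhoP.
have e20 : 0 < e / 2 by rewrite divr_gt0.
have dist : (e%:E <= quotient_seminorm rho (pi x - pi y)%R)%E.
  rewrite leNgt; apply/negP.
  rewrite -quotient_piB => /quotient_seminorm_lt[z zE ze].
  (* As [z] represents [pi (x - y)], the point [x - y - z] lies in [M], yet it is within [e] of
     [x - y]. *)
  apply: (sub (x - y - z)); last by rewrite /= quotient_piE zE.
  rewrite /seminorm_ball /= extended_seminorm_distC; last by case: rhoP.
  by rewrite opprB addrC subrK.
exists (seminorm_ball (quotient_seminorm rho) (pi x) (e / 2),
        seminorm_ball (quotient_seminorm rho) (pi y) (e / 2)) => /=.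
  by split; apply/mem_set; exact: seminorm_ball_center.
split; [exact: sopen | exact: sopen | apply/eqP/seteqP; split=> // r []].
rewrite /seminorm_ball /= => rx ry.
move: dist; apply/negP; rewrite -ltNge.
apply: le_lt_trans (extended_seminorm_dist_triangle sP r _ _) _.
by rewrite extended_seminorm_distC // [e]splitr EFinD lteD.
Qed.

Lemma barrel_preimage (B : set (quotient_space M)) :
  barrel B -> barrel (pi @^-1` B).
Proof.
move=> [Bclosed [Bbal Bconv] Babs]; split; [|split|].
- by apply: (continuous_closedP _).1 => //; exact: pi_continuous.
- by move=> a x a1 Bx; rewrite /= quotient_piZ; exact: Bbal.
- move=> x y t /set_mem Bx /set_mem By; apply/mem_set.
  have /set_mem := Bconv (pi x) (pi y) t (mem_set Bx) (mem_set By).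
  by rewrite /conv /= quotient_piD !quotient_piZ.
- by move=> x; have [r r0 rB] := Babs (pi x); exists r => // a ar;
    rewrite /= quotient_piZ; exact: rB.
Qed.

End QuotientSeminorm.

Theorem theorem3p22 (R : realType) (k : scalar_kind)
    (X : preTopologicalLmodType (scalars R k)) (M : submodClosed X) :
  barreled_elcs X -> closed [set` M] -> barreled_elcs (quotient_space M).
Proof.
move=> [[_ /seminorm_topologyP base] Xbarreled] Mclosed; split; [split|].
- exact: quotient_hausdorff.
- apply/seminorm_topologyP => q U.
  (* Neighborhoods of [pi x] pull back to neighborhoods of the lift [x], where [base] applies. *)
  have [x <-] := quotient_pi_surj q => /pi_continuous.
  move=> /base [rho [e [rhoP e0 sub]]].
  exists (@quotient_seminorm _ _ _ M rho), e; split=> //.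
    exact: continuous_quotient_seminorm.
  exact: quotient_seminorm_ball_sub.
- move=> B /barrel_preimage /Xbarreled /base [rho [e [rhoP e0 sub]]].
  have [sP sopen] := continuous_quotient_seminorm M rhoP.
  apply: filterS (quotient_seminorm_ball_sub sub) _.
  rewrite quotient_pi0; apply: open_nbhs_nbhs; split; first exact: sopen.
  exact: seminorm_ball_center.
Qed.
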